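(* Let $\alpha$ be a probability distribution on $[d]$ with $\alpha_1\ge\cdots\ge\alpha_d$, let $n\in\mathbb N$, $k\in[d]$, and $\lambda\sim\mathrm{SW}^n(\alpha)$. Then \[ \mathbb E\big[(\lambda_k-\alpha_k n)^2\big]\le 42\,\alpha_k k\, n+42\,(\alpha_k+\alpha_{k+1}+\cdots+\alpha_d)\,n . \] Consequently $\mathbb E[(\lambda_k-\alpha_kn)^2]\le O(\min\{1,\alpha_kd\}\,n)$.
   Context: For a word $w\in[d]^n$, $\mathrm{shRSK}(w)$ denotes the RSK shape: the Young diagram $\lambda_1\ge\cdots\ge\lambda_d\ge0$ with $\sum\lambda_i=n$ such that $\lambda_1+\cdots+\lambda_k$ equals the maximum total length of a union of $k$ disjoint weakly increasing subsequences of $w$ (Greene's theorem). $\mathrm{SW}^n(\alpha)$ is the law of $\mathrm{shRSK}(\boldsymbol w)$ for $\boldsymbol w\in[d]^n$ with i.i.d. letters distributed as $\alpha$. *)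

(* Defs.v *)
From HB Require Import structures.
From mathcomp Require Import all_boot all_order all_algebra.
Set Implicit Arguments. Unset Strict Implicit. Unset Printing Implicit Defensive.

Definition word (d n : nat) := {ffun 'I_n -> 'I_d}.

(* A partial colouring c of the positions with k colours (None = uncoloured)
   is valid for w if every colour class is a weakly increasing subsequence of w.
   The coloured positions then form a union of k disjoint weakly increasing
   subsequences, and every such union arises this way. *)
Definition inc_colouring (d n k : nat) (w : word d n)
  (c : {ffun 'I_n -> option 'I_k}) : bool :=
  [forall t : 'I_k, forall i : 'I_n, forall j : 'I_n,
     [&& (i < j)%N, c i == Some t & c j == Some t] ==> (w i <= w j)%N].

Definition coloured_len (n k : nat) (c : {ffun 'I_n -> option 'I_k}) : nat :=
  #|[set i : 'I_n | c i != None]|.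

(* greene k w = maximum total length of a union of k disjoint weakly
   increasing subsequences of w  (= lambda_1 + ... + lambda_k by Greene). *)
Definition greene (d n k : nat) (w : word d n) : nat :=
  \max_(c : {ffun 'I_n -> option 'I_k} | inc_colouring w c) coloured_len c.

(* The RSK shape row lambda_{k+1} (paper index k+1, our index k : 'I_d). *)
Definition shRSK_row (d n : nat) (w : word d n) (k : nat) : nat :=
  greene (k.+1) w - greene k w.

Definition word_prob (R : pzSemiRingType) (d n : nat) (alpha : 'I_d -> R)
  (w : word d n) : R :=
  (\prod_(i : 'I_n) alpha (w i))%R.

(* Main.v *)
Require Import Defs.
From HB Require Import structures.
From mathcomp Require Import all_boot all_order all_algebra.
From mathcomp Require Import ring lra zify.
Import Order.TTheory GRing.Theory Num.Theory.
Set Implicit Arguments. Unset Strict Implicit. Unset Printing Implicit Defensive.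

(** A family of [k] disjoint weakly increasing subsequences is a strictly
    increasing [k]-tuple of letters [S t] that moves up with the time [t], the
    letter [w t] being covered when it lies in [S t].  Removing the top entry of
    a [(k+1)]-tuple leaves a nondecreasing path with values at least [k]; adding
    the least missing letter to a [k]-tuple adds a nonincreasing path with values
    at most [k].  Hence the row number [k] (from 0) lies between the least number
    of hits of a nonincreasing path in [0..k] and the largest number of hits of a
    nondecreasing path in [k..d-1].

    Both path problems are driven by particle systems (PushTASEP and TASEP) whose
    gaps form queues in tandem.  Slowing or accelerating the leading particle by
    [delta], at the expense of some letters, makes independent geometric gaps
    stationary, and the gaps bound the error for every initial state.  The second
    moment is then optimised at [delta ^ 2 ~ tail / n] for the upper bound, and
    at [delta ^ 2 ~ (k+1) alpha_k / n] for the lower bound. *)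

(** * Strictly increasing chains of letters and Greene's numbers *)

(* Insertion that keeps a strictly increasing list strict, raising duplicates;
   taking [minn] and [maxn] makes it monotone in all arguments. *)
Fixpoint strict_insert (z : nat) (s : seq nat) : seq nat :=
  if s is v :: s' then
    minn v z :: strict_insert (maxn (maxn v z) (minn v z).+1) s'
  else [:: z].

Lemma size_strict_insert z s : size (strict_insert z s) = (size s).+1.
Proof. by elim: s z => //= v s IH z; rewrite IH. Qed.

(** The minimum of [v] and [z] becomes the head and the maximum is carried on; it is raised only
    when [v = z], and then the head already holds it. *)
Lemma mem_strict_insert (z : nat) (s : seq nat) (y : nat) : y \in z :: s -> y \in strict_insert z s.
Proof.
elim: s z => [|v s IH] z //=; rewrite !in_cons.
have IH' x : (y == x) || (y \in s) -> y \in strict_insert x s.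
  by rewrite -in_cons; apply: IH.
case/or3P=> [/eqP yz|/eqP yv|ys]; last by rewrite IH' ?ys ?orbT.
- case: (leqP z v) => zv; first by rewrite yz; apply/orP; left; apply/eqP; lia.
  by apply/orP; right; apply: IH'; rewrite yz; apply/orP; left; apply/eqP; lia.
- case: (leqP v z) => vz; first by rewrite yv; apply/orP; left; apply/eqP; lia.
  by apply/orP; right; apply: IH'; rewrite yv; apply/orP; left; apply/eqP; lia.
Qed.

Lemma path_strict_insert x z s :
  (x < z)%N -> path ltn x s -> path ltn x (strict_insert z s).
Proof.
elim: s x z => [|v s IH] x z /=; first by move->.
move=> xz /andP[xv vs]; rewrite leq_min xv xz /=; apply: IH; first by lia.
by case: s vs => //= y s /andP[vy ->]; rewrite andbT; lia.
Qed.

Lemma sorted_strict_insert z s : sorted ltn s -> sorted ltn (strict_insert z s).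
Proof.
case: s => //= v s vs; apply: path_strict_insert; first by lia.
by case: s vs => //= y s /andP[vy ->]; rewrite andbT; lia.
Qed.

Lemma strict_insert_homo z z' s s' : (z <= z')%N -> all2 leq s s' ->
  all2 leq (strict_insert z s) (strict_insert z' s').
Proof.
elim: s s' z z' => [|v s IH] [|v' s'] z z' //= zz'; first by rewrite zz'.
case/andP=> vv' ss'; apply/andP; split; first by lia.
by apply: IH => //; lia.
Qed.

Lemma all2_leq_nth s s' i : all2 leq s s' -> (nth 0 s i <= nth 0 s' i)%N.
Proof. by elim: s s' i => [|v s IH] [|v' s'] // [|i] //= /andP[? /IH]. Qed.

Lemma all2_leq_from_nth s s' : size s = size s' ->
  (forall i, (i < size s)%N -> (nth 0 s i <= nth 0 s' i)%N) -> all2 leq s s'.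
Proof.
elim: s s' => [|v s IH] [|v' s'] //= [ss] H; rewrite (H 0%N) //=.
by apply: IH => // i si; apply: (H i.+1).
Qed.

Lemma sorted_ltn_nth_ge s i : sorted ltn s -> (i < size s)%N -> (i <= nth 0 s i)%N.
Proof.
move=> ss; elim: i => // i IH si; apply: leq_ltn_trans (IH (ltnW si)) _.
by apply: (sorted_ltn_nth ltn_trans) => //; rewrite inE // ltnW.
Qed.

(** Colour [t] is given to the positions whose letter is entry [t] of the moving tuple; since that
    entry never decreases, the class is weakly increasing. *)
Lemma greene_ge (d n k : nat) (w : word d n) (S : nat -> seq nat) :
  (forall t, size (S t) = k) -> (forall t t', (t <= t')%N -> all2 leq (S t) (S t')) ->
  (\sum_(i < n) (val (w i) \in S i) <= greene k w)%N.
Proof.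
move=> Sk Sm.
pose c : {ffun 'I_n -> option 'I_k} := [ffun t : 'I_n => insub (index (val (w t)) (S t))].
have cE i t : c i = Some t -> val (w i) = nth 0 (S i) t.
  rewrite ffunE; case: insubP => // u uk uE [<-]; rewrite uE nth_index //.
  by rewrite -index_mem Sk.
have cv : inc_colouring w c.
  apply/forallP=> t; apply/forallP=> i; apply/forallP=> j; apply/implyP.
  case/and3P=> ij /eqP/cE wi /eqP/cE wj.
  by rewrite wi wj; apply: all2_leq_nth; apply/Sm/ltnW.
apply: leq_trans (leq_bigmax_cond _ cv).
rewrite /coloured_len -sum1_card [X in (_ <= X)%N]big_mkcond /=; apply: leq_sum => i _.
rewrite inE ffunE; case: insubP => //=; last by rewrite -{1}(Sk i) index_mem => /negbTE->.
by case: (_ \in _).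
Qed.

(** Each colour of an optimal colouring becomes the running maximum of its letters, and
    [strict_insert] merges these nondecreasing paths into one strict tuple that still contains each
    of them. *)
Lemma greene_le_chain (d n k : nat) (w : word d n) :
  exists S : nat -> seq nat,
  [/\ forall t, size (S t) = k, forall t, sorted ltn (S t),
      forall t t', (t <= t')%N -> all2 leq (S t) (S t') &
      (greene k w <= \sum_(i < n) (val (w i) \in S i))%N].
Proof.
have [c cv cE] : {c | inc_colouring w c & greene k w = coloured_len (k := k) c}.
  apply: eq_bigmax_cond; apply/card_gt0P; exists [ffun=> None].
  apply/forallP=> t; apply/forallP=> i; apply/forallP=> j.
  by rewrite !ffunE /= !andbF.
pose v (i : 'I_k) (t : nat) := (\max_(s : 'I_n | (s <= t) && (c s == Some i)) val (w s))%N.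
have vm i t t' : (t <= t')%N -> (v i t <= v i t')%N.
  move=> tt'; apply/bigmax_leqP => s /andP[st cs].
  by apply: (bigop.bigmax_sup s) => //; rewrite cs (leq_trans st).
have vE i (t : 'I_n) : c t = Some i -> v i t = val (w t).
  move=> ct; apply/eqP; rewrite eqn_leq; apply/andP; split; last first.
    by apply: (bigop.bigmax_sup t) => //; rewrite leqnn ct eqxx.
  apply/bigmax_leqP => s /andP[st cs].
  move: st; rewrite leq_eqVlt => /orP[/eqP/val_inj->//|st].
  move/forallP/(_ i)/forallP/(_ s)/forallP/(_ t)/implyP: cv; apply.
  by rewrite st cs ct eqxx.
pose S t := foldr strict_insert [::] [seq v i t | i <- enum 'I_k].
exists S; split.
- move=> t; rewrite /S -[RHS]size_enum_ord.
  by elim: (enum _) => //= i e IH; rewrite size_strict_insert IH.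
- by move=> t; rewrite /S; elim: (enum _) => //= i e IH; apply: sorted_strict_insert.
- move=> t t' tt'; rewrite /S; elim: (enum _) => //= i e IH.
  by apply: strict_insert_homo => //; apply: vm.
- rewrite cE /coloured_len -sum1_card big_mkcond /=; apply: leq_sum => i _.
  rewrite inE; case ct: (c i) => [t|] //=; rewrite -(vE _ _ ct) /S.
  have: t \in enum 'I_k by rewrite mem_enum.
  elim: (enum _) => //= j e IH; rewrite inE => /orP[/eqP<-|/IH te].
    by rewrite mem_strict_insert // mem_head.
  by rewrite mem_strict_insert // inE; case: (_ \in foldr _ _ _) te => //; rewrite orbT.
Qed.

Lemma greene_succ_le (d n k : nat) (w : word d n) :
  exists u : nat -> nat,
  [/\ forall t t', (t <= t')%N -> (u t <= u t')%N, forall t, (k <= u t)%N &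
      (greene k.+1 w <= greene k w + \sum_(i < n) (val (w i) == u i))%N].
Proof.
have [S [Sk Ss Sm Sg]] := greene_le_chain k.+1 w.
exists (fun t => nth 0 (S t) k); split.
- by move=> t t' /Sm/all2_leq_nth.
- by move=> t; apply: sorted_ltn_nth_ge => //; rewrite Sk.
apply: leq_trans Sg _.
apply: (@leq_trans (\sum_(i < n) (val (w i) \in take k (S i)) +
  \sum_(i < n) (val (w i) == nth 0 (S i) k))%N); last first.
  rewrite leq_add2r; apply: (@greene_ge d n k w (fun t => take k (S t))).
  - by move=> t; rewrite size_take Sk ltnSn.
  - move=> t t' tt'; apply: all2_leq_from_nth; first by rewrite !size_take !Sk.
    move=> i; rewrite size_take Sk ltnSn => ik; rewrite !nth_take //.
    exact/all2_leq_nth/Sm.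
rewrite -big_split /=; apply: leq_sum => i _.
rewrite -{1}[S i](cat_take_drop k) mem_cat (drop_nth 0) ?Sk // drop_oversize ?Sk //.
by rewrite inE; case: (_ \in _); case: (_ == _).
Qed.

Lemma greene_succ_ge (d n k : nat) (w : word d n) :
  exists u : nat -> nat,
  [/\ forall t t', (t <= t')%N -> (u t' <= u t)%N, forall t, (u t <= k)%N &
      (greene k w + \sum_(i < n) (val (w i) == u i) <= greene k.+1 w)%N].
Proof.
have [S [Sk Ss Sm Sg]] := greene_le_chain k w.
(* [u t] is the least letter missing from [S t], or [k] if all entries are on the diagonal. Entries
   below [u t] equal their index and later ones exceed it, so [maxn i.+1] makes [T t] equal to [S t]
   with [u t] inserted. *)
pose u t := find (fun i => nth 0 (S t) i != i) (iota 0 k).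
pose T t := 0%N :: mkseq (fun i => maxn i.+1 (nth 0 (S t) i)) k.
have uk t : (u t <= k)%N by rewrite -[X in (_ <= X)%N](size_iota 0 k) find_size.
have u_lt t i : (i < u t)%N -> nth 0 (S t) i = i.
  move=> iu; have ik : (i < k)%N by apply: leq_trans iu (uk t).
  by move: (before_find 0%N iu); rewrite nth_iota // => /negbT/negPn/eqP.
have u_ge t i : (u t <= i < k)%N -> (i < nth 0 (S t) i)%N.
  case/andP=> ui ik; have utk := leq_ltn_trans ui ik.
  have : has (fun i => nth 0 (S t) i != i) (iota 0 k) by rewrite has_find size_iota.
  move/(nth_find 0%N); rewrite -/(u t) nth_iota // add0n => neq.
  elim: i ui ik => [|i IH] ui ik.
    by move: ui neq; rewrite leqn0 => /eqP->; rewrite lt0n.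
  move: ui; rewrite leq_eqVlt => /orP[/eqP<-|ui].
    have := sorted_ltn_nth_ge (Ss t); move=> /(_ (u t)); rewrite Sk => /(_ utk).
    by rewrite leq_eqVlt eq_sym (negbTE neq).
  apply: leq_ltn_trans (IH ui (ltnW ik)) _.
  by apply: (sorted_ltn_nth ltn_trans) => //; rewrite inE Sk // ltnW.
exists u; split => //.
  (* If [u t < u t'], entry [u t] would be above the diagonal at time [t] but on it at the later
     time [t']. *)
  move=> t t' tt'; rewrite leqNgt; apply/negP => lt.
  have /u_lt := lt; have := u_ge t (u t).
  rewrite leqnn (leq_trans lt) // => /(_ isT).
  have := all2_leq_nth (u t) (Sm _ _ tt'); lia.
have TE t i : (i < k)%N -> nth 0 (T t) i.+1 = maxn i.+1 (nth 0 (S t) i).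
  by move=> ik; rewrite /= nth_mkseq.
have szT t : size (T t) = k.+1 by rewrite /= size_mkseq.
have Tdiag t i : (i <= u t)%N -> nth 0 (T t) i = i.
  case: i => // i iu; rewrite TE ?u_lt //; last exact: leq_trans iu (uk t).
  by apply/maxn_idPl.
have Tmem t i : (i <= k)%N -> nth 0 (T t) i \in T t by move=> ik; rewrite mem_nth ?szT.
have /= := @greene_ge d n k.+1 w T szT.
have Tm t t' : (t <= t')%N -> all2 leq (T t) (T t').
  move=> tt'; apply: all2_leq_from_nth; first by rewrite !szT.
  case=> // i; rewrite szT ltnS => ik; rewrite !TE //.
  have := all2_leq_nth i (Sm _ _ tt'); lia.
move/(_ Tm); apply: leq_trans.
apply: leq_trans (leq_add Sg (leqnn _)) _; rewrite -big_split /=.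
apply: leq_sum => i _; set x := val (w i).
have uT : u i \in T i by rewrite -{1}(Tdiag i (u i)) // Tmem.
have [->|xu] := eqVneq x (u i).
  rewrite uT; suff -> : u i \in S i = false by [].
  apply/negP => /(nthP 0)[j]; rewrite Sk => jk jE.
  have [ju|uj] := ltnP j (u i); first by move: (ju); rewrite -jE u_lt ?ltnn.
  by have := u_ge i j; rewrite uj jk jE ltnNge uj => /(_ isT).
rewrite addn0; case: (boolP (x \in S i)) => // /(nthP 0)[j]; rewrite Sk => jk jE.
suff -> : x \in T i by [].
have [ju|uj] := ltnP j (u i).
  by rewrite -jE u_lt // -(Tdiag i j) ?Tmem // ltnW.
rewrite -jE -(_ : nth 0 (T i) j.+1 = nth 0 (S i) j) ?Tmem // TE //.
by apply/maxn_idPr; apply: u_ge; rewrite uj jk.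
Qed.

(** * Queues in tandem *)

(* A state lists the lengths of queues in tandem.  [signal] serves the first
   nonempty queue; [push j] is an arrival at queue [j], which signals the queues
   beyond it; [serve j] moves a customer from queue [j] to queue [j + 1]. *)
Fixpoint signal (c : seq nat) : seq nat :=
  if c is x :: c' then (if x is y.+1 then y :: c' else 0%N :: signal c') else [::].

Fixpoint push (j : nat) (c : seq nat) {struct c} : seq nat :=
  if c is x :: c' then (if j is i.+1 then x :: push i c' else x.+1 :: signal c')
  else [::].

Definition arrive (c : seq nat) : seq nat :=
  if c is x :: c' then x.+1 :: c' else [::].

Fixpoint serve (j : nat) (c : seq nat) {struct c} : seq nat :=
  if c is x :: c' then
    if j is i.+1 then x :: serve i c'
    else if x is y.+1 then y :: arrive c' else c
  else [::].

Lemma size_signal c : size (signal c) = size c.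
Proof. by elim: c => //= -[|x] c IH //=; rewrite IH. Qed.

Lemma size_push j c : size (push j c) = size c.
Proof. by elim: c j => //= x c IH [|j] /=; rewrite ?size_signal ?IH. Qed.

Lemma size_arrive c : size (arrive c) = size c.
Proof. by case: c. Qed.

Lemma size_serve j c : size (serve j c) = size c.
Proof. by elim: c j => //= x c IH [|j] /=; [case: x => //= x; rewrite size_arrive | rewrite IH]. Qed.

Lemma sumn_take_mono j j' c : (j <= j')%N -> (sumn (take j c) <= sumn (take j' c))%N.
Proof. by elim: c j j' => //= x c IH [|j] [|j'] //= jj'; rewrite leq_add2l IH. Qed.

Lemma sumn_take_le j c : (sumn (take j c) <= sumn c)%N.
Proof. by elim: c j => //= x c IH [|j] //=; rewrite leq_add2l. Qed.

Lemma sumn_take_signal j c : (sumn (take j c) <= (sumn (take j (signal c))).+1)%N.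
Proof. by elim: c j => [|[|x] c IH] [|j] //=; rewrite ?add0n ?IH //; lia. Qed.

(** Prefixes ending before queue [i] do not change, the one ending at it gains the arrival, and in
    longer ones the arrival makes up for the customer removed by the signal. *)
Lemma sumn_take_push i j c : (i < size c)%N ->
  ((j == i.+1) + sumn (take j c) <= sumn (take j (push i c)))%N.
Proof.
elim: c i j => [|x c IH] [|i] [|j] //= ic.
  by case: j => [|j]; [rewrite !take0 /=; lia | have := sumn_take_signal j.+1 c; lia].
by have := IH i j ic; rewrite eqSS; lia.
Qed.

Lemma sumn_take_arrive j c : (j <= size c)%N ->
  ((sumn (take j c)).+1 <= (j == 0) + sumn (take j (arrive c)))%N.
Proof. by case: c j => [|x c] [|j] //=; lia. Qed.

(** Only the prefix ending at queue [i] loses the customer; a longer one, being within the state,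
    also contains queue [i + 1]. *)
Lemma sumn_take_serve i j c : (j <= size c)%N ->
  (sumn (take j c) <= (j == i.+1) + sumn (take j (serve i c)))%N.
Proof.
elim: c i j => [|x c IH] [|i] [|j] //= jc.
  case: x => [|x] /=; first by lia.
  have := sumn_take_arrive jc; rewrite eqSS; lia.
by have := IH i j jc; rewrite eqSS; lia.
Qed.


(** * Rows compared with hits of paths, and hits with queue lengths *)

Section Domination.
Variables (d : nat) (k : 'I_d).
Implicit Types (s : seq ('I_d * bool)) (u : nat -> nat) (c : seq nat).

Fixpoint hits (s : seq 'I_d) u : nat :=
  if s is x :: s' then (x == u 0 :> nat) + hits s' (fun t => u t.+1) else 0.

Lemma hitsE n (s : seq 'I_d) u : size s = n ->
  \sum_(i < n) (val ([ffun i : 'I_n => nth k s i] i) == u i) = hits s u.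
Proof.
move=> <-; elim: s u => [|x s IH] u; first by rewrite big_ord0.
rewrite big_ord_recl ffunE /= -IH; congr (_ + _).
by apply: eq_bigr => i _; rewrite !ffunE.
Qed.

Lemma hits_le_count (s : seq 'I_d) u : (forall t, k <= u t) ->
  hits s u <= count (fun j : 'I_d => k <= j) s.
Proof.
elim: s u => //= x s IH u ku; apply: leq_add; last by apply: IH.
by case: eqP => // ->; rewrite ku.
Qed.

(* A marked letter above [k] is treated as the letter [k]. *)
Definition upper_step c (e : 'I_d * bool) : seq nat :=
  if e.1 < k then c else if e.2 || (e.1 == k) then signal c else push (e.1 - k.+1) c.

(* Queue [i] holds the gap between the particles of the letters [k - i] and
   [k - i - 1]; unmarked letters are ignored. *)
Definition lower_step c (e : 'I_d * bool) : seq nat :=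
  if e.2 && (e.1 <= k) then if e.1 == k then arrive c else serve (k - e.1.+1) c
  else c.

(** The content of the queues below the level of the path is a potential. A push at the letter of
    the path raises it by one and pays for the hit. A signal lowers it by at most one: a letter [k]
    pays once, as a hit at [k] finds an empty prefix, and a marked letter pays twice, as it may be a
    hit too. The path moves only up, so the prefix only grows. *)
Lemma hits_le_queue s c u : size c = d - k.+1 ->
  (forall t t', t <= t' -> u t <= u t') -> (forall t, k <= u t) ->
  hits (map fst s) u + sumn (take (u 0 - k) c)
  <= count (fun e : 'I_d * bool => e.1 == k) s + 2 * count (fun e : 'I_d * bool => e.2 && (k < e.1)) s
     + sumn (foldl upper_step c s).
Proof.
elim: s c u => [|[x b] s IH] c u sc um ku.
  by rewrite /= !add0n sumn_take_le.
rewrite [map _ _]/= [hits _ _]/= [foldl _ _ _]/=.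
set c' := upper_step c (x, b); rewrite [count _ _]/= [count (fun e : 'I_d * bool => e.2 && _) _]/=.
have sc' : size c' = d - k.+1.
  by rewrite /c' /upper_step; case: ifP => // _; case: ifP => _; rewrite ?size_signal ?size_push.
have {IH} := IH c' (fun t => u t.+1) sc' (fun t t' tt' => um _ _ (tt' : t < t'.+1))
  (fun t => ku t.+1).
have u01 : u 0 - k <= u 1 - k by apply/leq_sub2r/um.
have := sumn_take_mono c' u01.
suff : (x == u 0 :> nat) + sumn (take (u 0 - k) c)
   <= (x == k) + 2 * (b && (k < x)) + sumn (take (u 0 - k) c').
  move: (nat_of_bool (x == u 0 :> nat)) (nat_of_bool (x == k)).
  by move: (nat_of_bool (b && _)) (hits _ _) (count _ _) (count _ _); lia.
have k0 := ku 0; rewrite /c' /upper_step /= {c' sc'}.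
case: (ssrnat.ltngtP x k) => [xk|kx|/val_inj xk].
- have -> : (x == u 0 :> nat) = false by apply/negbTE; rewrite neq_ltn (leq_trans xk k0).
  by rewrite (_ : (x == k) = false) ?andbF //; apply/negbTE/eqP => E; move: xk; rewrite E ltnn.
- have -> : (x == k) = false by apply/negbTE/eqP => E; move: kx; rewrite E ltnn.
  rewrite orbF andbT; case: b => /=.
    by have := sumn_take_signal (u 0 - k) c; case: eqP => _ /=; lia.
  have xc : x - k.+1 < size c by rewrite sc; have := ltn_ord x; lia.
  have := sumn_take_push (u 0 - k) xc.
  by rewrite (_ : (u 0 - k == (x - k.+1).+1) = (x == u 0 :> nat)) //; apply/eqP/eqP; lia.
- rewrite xk eqxx orbT andbF; have := sumn_take_signal (u 0 - k) c.
  case: eqP => [->|_] /=; last by lia.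
  by rewrite subnn !take0.
Qed.

(** The dual potential: an arrival raises every nonempty prefix, and the prefix is empty exactly
    when the path is at [k], where the letter is a hit. A service lowers the prefix only if the
    letter served is the one of the path, again a hit. *)
Lemma queue_le_hits s c u : size c = k ->
  (forall t t', t <= t' -> u t' <= u t) -> (forall t, u t <= k) ->
  count (fun e : 'I_d * bool => e.2 && (e.1 == k)) s + sumn (take (k - u 0) c)
  <= hits (map fst s) u + sumn (foldl lower_step c s).
Proof.
elim: s c u => [|[x b] s IH] c u sc um ku.
  by rewrite /= !add0n sumn_take_le.
rewrite [map _ _]/= [hits _ _]/= [foldl _ _ _]/=.
set c' := lower_step c (x, b); rewrite [count _ _]/=.
have sc' : size c' = k.
  by rewrite /c' /lower_step; case: ifP => // _; case: ifP => _; rewrite ?size_arrive ?size_serve.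
have {IH} := IH c' (fun t => u t.+1) sc' (fun t t' tt' => um _ _ (tt' : t < t'.+1))
  (fun t => ku t.+1).
have u01 : k - u 0 <= k - u 1 by apply/leq_sub2l/um.
have := sumn_take_mono c' u01.
suff : (b && (x == k)) + sumn (take (k - u 0) c)
   <= (x == u 0 :> nat) + sumn (take (k - u 0) c').
  move: (nat_of_bool (x == u 0 :> nat)) (nat_of_bool (b && _)).
  by move: (hits _ _) (count _ _); lia.
have k0 := ku 0; rewrite /c' /lower_step /= {c' sc'}.
case: b => //=; last by lia.
have jc : k - u 0 <= size c by rewrite sc leq_subr.
case: (ssrnat.ltngtP x k) => [xk|kx|/val_inj xk].
- have -> : (x == k) = false by apply/negbTE/eqP => E; move: xk; rewrite E ltnn.
  have := sumn_take_serve (k - x.+1) jc.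
  by rewrite (_ : (k - u 0 == (k - x.+1).+1) = (x == u 0 :> nat)) //; apply/eqP/eqP; lia.
- rewrite (_ : (x == k) = false); last by apply/negbTE/eqP => E; move: kx; rewrite E ltnn.
  by lia.
- rewrite xk eqxx; have := sumn_take_arrive jc.
  by rewrite (_ : (k - u 0 == 0) = (k == u 0 :> nat)); [lia | apply/eqP/eqP; lia].
Qed.

Definition rsk_row (s : seq 'I_d) : nat :=
  shRSK_row [ffun i : 'I_(size s) => nth k s i] k.

Lemma row_le_count (s : seq 'I_d) : rsk_row s <= count (fun j : 'I_d => k <= j) s.
Proof.
rewrite /rsk_row /shRSK_row; set w := [ffun _ => _].
have [u [_ ku]] := greene_succ_le k w; rewrite hitsE // => H.
by have := hits_le_count s ku; lia.
Qed.

(** The initial state [c] is free, so that the bound can later be averaged over stationary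
    states. *)
Lemma row_le_queue s c : size c = d - k.+1 ->
  rsk_row (map fst s) <= count (fun e : 'I_d * bool => e.1 == k) s
    + 2 * count (fun e : 'I_d * bool => e.2 && (k < e.1)) s + sumn (foldl upper_step c s).
Proof.
move=> sc; rewrite /rsk_row /shRSK_row; set w := [ffun _ => _].
have [u [um ku]] := greene_succ_le k w; rewrite hitsE // => H.
by have := hits_le_queue s sc um ku; lia.
Qed.

Lemma row_ge_queue s c : size c = k ->
  count (fun e : 'I_d * bool => e.2 && (e.1 == k)) s <= rsk_row (map fst s) + sumn (foldl lower_step c s).
Proof.
move=> sc; rewrite /rsk_row /shRSK_row; set w := [ffun _ => _].
have [u [um ku]] := greene_succ_ge k w; rewrite hitsE // => H.
by have := queue_le_hits s sc um ku; lia.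
Qed.

End Domination.

Local Open Scope ring_scope.

(** * Truncated geometric weights: invariance, moments and mass *)

Section GeometricSums.
Context {R : realFieldType}.
Implicit Types (q : R) (qs rs : seq R) (f g : seq nat -> R).

(* Independent geometric queues, truncated at [N] because an arbitrary real field
   has no infinite sums. *)
Fixpoint gsum (N : nat) qs f : R :=
  if qs is q :: qs' then
    \sum_(i < N.+1) q ^+ i * gsum N qs' (fun c => f (val i :: c))
  else f [::].

Lemma ler_gsum N qs f g : all (>= 0) qs ->
  (forall c, size c = size qs -> f c <= g c) -> gsum N qs f <= gsum N qs g.
Proof.
elim: qs f g => [|q qs IH] f g /=; first by move=> _; apply.
case/andP=> q0 qs0 fg; apply: ler_sum => i _; apply: ler_wpM2l.
  exact: exprn_ge0.
by apply: IH => // c cs; apply: fg; rewrite /= cs.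
Qed.

Lemma eq_gsum N qs f g : (forall c, size c = size qs -> f c = g c) ->
  gsum N qs f = gsum N qs g.
Proof.
elim: qs f g => [|q qs IH] f g /= fg; first exact: fg.
by apply: eq_bigr => i _; congr (_ * _); apply: IH => c cs; apply: fg; rewrite /= cs.
Qed.

Lemma gsum_sum (I : Type) (r : seq I) (P : pred I) (a : I -> R) (F : I -> seq nat -> R) N qs :
  gsum N qs (fun c => \sum_(i <- r | P i) a i * F i c)
  = \sum_(i <- r | P i) a i * gsum N qs (F i).
Proof.
elim: qs F => //= q qs IH F.
under eq_bigr do rewrite IH mulr_sumr.
rewrite exchange_big /=; apply: eq_bigr => i _; rewrite mulr_sumr.
by apply: eq_bigr => j _; rewrite mulrCA.
Qed.

Lemma gsumZ N qs a f : gsum N qs (fun c => a * f c) = a * gsum N qs f.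
Proof.
elim: qs f => //= q qs IH f; rewrite mulr_sumr.
by apply: eq_bigr => i _; rewrite IH mulrCA.
Qed.

Lemma gsumD N qs (f g : seq nat -> R) :
  gsum N qs (fun c => f c + g c) = gsum N qs f + gsum N qs g.
Proof.
elim: qs f g => //= q qs IH f g; rewrite -big_split; apply: eq_bigr => i _.
by rewrite IH mulrDr.
Qed.

Lemma gsum_ge0 N qs f : all (>= 0) qs -> (forall c, 0 <= f c) -> 0 <= gsum N qs f.
Proof.
move=> qs0 f0; apply: le_trans (_ : gsum N qs (fun=> 0 * 0) <= _).
  by rewrite gsumZ mul0r.
by apply: ler_gsum => // c _; rewrite mul0r.
Qed.

Lemma gsum_leS N qs f : all (>= 0) qs -> (forall c, 0 <= f c) ->
  gsum N qs f <= gsum N.+1 qs f.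
Proof.
elim: qs f => //= q qs IH f /andP[q0 qs0] f0.
rewrite [leRHS]big_ord_recr /= -[leLHS]addr0; apply: lerD.
  by apply: ler_sum => i _; apply: ler_wpM2l; [exact: exprn_ge0 | apply: IH].
by apply: mulr_ge0; [exact: exprn_ge0 | apply: gsum_ge0].
Qed.

Definition psum q (M : nat) (F : nat -> R) : R := \sum_(i < M) q ^+ i * F i.

Lemma gsum_cons N q qs f :
  gsum N (q :: qs) f = psum q N.+1 (fun i => gsum N qs (fun c => f (i :: c))).
Proof. by []. Qed.

Lemma ler_psum q M F G : 0 <= q -> (forall i, F i <= G i) -> psum q M F <= psum q M G.
Proof. by move=> q0 FG; apply: ler_sum => i _; apply: ler_wpM2l; rewrite ?exprn_ge0. Qed.

Lemma psum_leS q M F : 0 <= q -> (forall i, 0 <= F i) -> psum q M F <= psum q M.+1 F.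
Proof. by move=> q0 F0; rewrite /psum big_ord_recr lerDl mulr_ge0 ?exprn_ge0. Qed.

Lemma psumS q M F : psum q M.+1 F = F 0%N + q * psum q M (fun i => F i.+1).
Proof.
rewrite /psum big_ord_recl expr0 mul1r mulr_sumr; congr (_ + _).
by apply: eq_bigr => i _; rewrite exprS mulrA.
Qed.

Lemma psumD q M F G : psum q M (fun i => F i + G i) = psum q M F + psum q M G.
Proof. by rewrite -big_split; apply: eq_bigr => i _; rewrite mulrDr. Qed.

Lemma psumZ q M a F : psum q M (fun i => a * F i) = a * psum q M F.
Proof. by rewrite mulr_sumr; apply: eq_bigr => i _; rewrite mulrCA. Qed.

Lemma psum_sum q M (I : Type) (r : seq I) (F : I -> nat -> R) :
  \sum_(j <- r) psum q M (F j) = psum q M (fun i => \sum_(j <- r) F j i).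
Proof. by rewrite exchange_big; apply: eq_bigr => i _; rewrite mulr_sumr. Qed.

(* Reversibility of the tandem queues: [b * q = r] makes an arrival in the
   first queue as likely as the time reversal of a departure from it. *)
Lemma gsum_push N (b : R) rs f : 0 < b -> all (>= 0) rs -> (forall c, 0 <= f c) ->
  let qs := [seq r / b | r <- rs] in
  b * gsum N qs (fun c => f (signal c))
  + \sum_(i < size rs) rs`_i * gsum N qs (fun c => f (push i c))
  <= (b + \sum_(i < size rs) rs`_i) * gsum N.+1 qs f.
Proof.
move=> b0; elim: rs f => [|r rs IH] f; first by rewrite /= !big_ord0 !addr0.
case/andP=> r0 rs0 f0; cbv zeta; rewrite map_cons [size (r :: rs)]/=.
set q := r / b; set qs := [seq _ | _ <- rs].
have q0 : 0 <= q by rewrite divr_ge0 // ltW.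
have qs0 : all (>= 0) qs.
  by rewrite all_map; apply: sub_all rs0 => x /= x0; rewrite divr_ge0 // ltW.
have bq : b * q = r by rewrite mulrC divfK ?gt_eqF.
pose A i := gsum N qs (fun c => f (i :: signal c)).
pose B i := gsum N qs (fun c => f (i :: c)).
pose C i := \sum_(j < size rs) rs`_j * gsum N qs (fun c => f (i :: push j c)).
pose D i := gsum N.+1 qs (fun c => f (i :: c)).
pose rho := \sum_(j < size rs) rs`_j.
have BD i : B i <= D i by apply: gsum_leS.
have C0 i : 0 <= C i.
  apply: sumr_ge0 => j _; apply: mulr_ge0; last exact: gsum_ge0.
  by apply: (allP rs0); rewrite mem_nth.
have B0 i : 0 <= B i by apply: gsum_ge0.
have E1 : gsum N (q :: qs) (fun c => f (signal c)) = A 0%N + q * psum q N B.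
  by rewrite gsum_cons psumS.
have E2 : gsum N (q :: qs) (fun c => f (push 0 c)) = psum q N.+1 (fun i => A i.+1).
  by [].
have E3 : \sum_(i < size rs) rs`_i * gsum N (q :: qs) (fun c => f (push i.+1 c))
          = psum q N.+1 C.
  by under eq_bigr do rewrite gsum_cons -psumZ; rewrite psum_sum.
rewrite !big_ord_recl; rewrite [X in _ + (_ + X)]E3 E1 E2 gsum_cons -/rho /=.
have AP := psumS q N.+1 A.
(* Signals that find the first queue empty and those sent by its arrivals add up to signals of
   weight [b] for the other queues, to which the induction hypothesis applies. *)
have H1 : b * psum q N.+2 A + psum q N.+2 C <= (b + rho) * psum q N.+2 D.
  rewrite -!psumZ -psumD; apply: ler_psum => // i.
  exact: (IH (fun c => f (i :: c))).
have H2 : psum q N B <= psum q N.+2 D.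
  apply: le_trans (psum_leS _ q0 B0) (le_trans (psum_leS _ q0 B0) _).
  exact: ler_psum.
have H3 := psum_leS N.+1 q0 C0.
have := ler_wpM2l r0 H2; rewrite -/D; nra.
Qed.

(** Since [a * q = l], arrivals at the first queue and its idle services together give weight [a] to
    the whole sum, while its departures are arrivals of weight [l] for the other queues, where the
    induction applies. *)
Lemma gsum_serve N (l a : R) m f : 0 <= l -> 0 < a -> (forall c, 0 <= f c) ->
  let qs := nseq m (l / a) in
  l * gsum N qs (fun c => f (arrive c))
  + \sum_(i < m) a * gsum N qs (fun c => f (serve i c))
  <= (l + a *+ m) * gsum N.+1 qs f.
Proof.
move=> l0 a0; elim: m f => [|m IH] f f0; first by rewrite /= big_ord0 !addr0.
cbv zeta; rewrite [nseq m.+1 _]/=; set q := l / a; set qs := nseq m q.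
have q0 : 0 <= q by rewrite divr_ge0 // ltW.
have qs0 : all (>= 0) qs by rewrite all_nseq q0 orbT.
have aq : a * q = l by rewrite mulrC divfK ?gt_eqF.
pose A i := gsum N qs (fun c => f (i :: arrive c)).
pose B i := gsum N qs (fun c => f (i :: c)).
pose C i := \sum_(j < m) a * gsum N qs (fun c => f (i :: serve j c)).
pose D i := gsum N.+1 qs (fun c => f (i :: c)).
have BD i : B i <= D i by apply: gsum_leS.
have A0 i : 0 <= A i by apply: gsum_ge0.
have C0 i : 0 <= C i.
  by apply: sumr_ge0 => j _; apply: mulr_ge0; [exact: ltW | exact: gsum_ge0].
have E1 : gsum N (q :: qs) (fun c => f (arrive c)) = psum q N.+1 (fun i => B i.+1).
  by [].
have E2 : gsum N (q :: qs) (fun c => f (serve 0 c)) = B 0%N + q * psum q N A.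
  by rewrite gsum_cons psumS.
have E3 : \sum_(i < m) a * gsum N (q :: qs) (fun c => f (serve i.+1 c))
          = psum q N.+1 C.
  by under eq_bigr do rewrite gsum_cons -psumZ; rewrite psum_sum.
rewrite big_ord_recl [X in _ + (_ + X)]E3 E1 E2 gsum_cons mulrSr /=.
have BP := psumS q N.+1 B.
have H1 : l * psum q N.+2 A + psum q N.+2 C <= (l + a *+ m) * psum q N.+2 D.
  rewrite -!psumZ -psumD; apply: ler_psum => // i.
  exact: (IH (fun c => f (i :: c))).
have H2 : a * psum q N.+2 B <= a * psum q N.+2 D.
  by apply: ler_wpM2l; [exact: ltW | exact: ler_psum].
have H3 := psum_leS N.+1 q0 C0.
have H4 : l * psum q N A <= l * psum q N.+2 A.
  apply: ler_wpM2l => //.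
  exact: le_trans (psum_leS _ q0 A0) (psum_leS _ q0 A0).
rewrite -/D; nra.
Qed.

(** For independent geometric variables with ratios [qs] and no truncation: the mean and the
    variance of their total, and the total weight. *)
Definition gmean qs : R := \sum_(q <- qs) q / (1 - q).
Definition gvar qs : R := \sum_(q <- qs) q / (1 - q) ^+ 2.
Definition gmass qs : R := \prod_(q <- qs) (1 - q)^-1.

Lemma gmass_gt0 qs : all (< 1) qs -> 0 < gmass qs.
Proof.
move=> qs1; rewrite /gmass big_seq; apply: prodr_gt0 => q /(allP qs1) q1.
by rewrite invr_gt0 subr_gt0.
Qed.

(* The right-hand side [h] is the infinite sum, the solution of
   [h y = y ^+ 2 + v + q * h (y + 1)]. *)
Lemma psum_sqr q M y v : 0 <= q < 1 -> 0 <= v ->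
  psum q M (fun i => (y + i%:R) ^+ 2 + v)
  <= (1 - q)^-1 * ((y + q / (1 - q)) ^+ 2 + q / (1 - q) ^+ 2 + v).
Proof.
case/andP=> q0 q1 v0; have p0 : 0 < 1 - q by rewrite subr_gt0.
elim: M y => [|M IH] y.
  rewrite /psum big_ord0; apply: mulr_ge0; first by rewrite invr_ge0 ltW.
  by rewrite !addr_ge0 ?sqr_ge0 // divr_ge0 // exprn_ge0 // ltW.
rewrite psumS addr0.
have -> : psum q M (fun i => (y + i.+1%:R) ^+ 2 + v)
        = psum q M (fun i => ((y + 1) + i%:R) ^+ 2 + v).
  by apply: eq_bigr => i _; rewrite -natr1 -addrA [1 + _]addrC.
apply: le_trans (lerD (lexx _) (ler_wpM2l q0 (IH _))) _.
rewrite le_eqVlt; apply/orP; left; apply/eqP; field; exact: lt0r_neq0.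
Qed.

(** Truncation only lowers the sum, and the full one is the mass times squared mean plus variance.
    The shift [x] absorbs the queues already summed. *)
Lemma gsum_sqr N qs x : all (fun q => 0 <= q < 1) qs ->
  gsum N qs (fun c => (x + (sumn c)%:R) ^+ 2)
  <= gmass qs * ((x + gmean qs) ^+ 2 + gvar qs).
Proof.
elim: qs x => [|q qs IH] x; first by rewrite /gmass /gmean /gvar !big_nil /= mul1r !addr0.
case/andP=> /[dup] q01 /andP[q0 q1] qs01.
have qs1 : all (< 1) qs by apply: sub_all qs01 => y /andP[].
rewrite /gmass /gmean /gvar !big_cons -/(gmass _) -/(gmean _) -/(gvar _) gsum_cons.
have v0 : 0 <= gvar qs.
  rewrite /gvar big_seq sumr_ge0 // => y /(allP qs01) /andP[y0 y1].
  by rewrite divr_ge0 // exprn_ge0 // subr_ge0 ltW.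
have IHi i : gsum N qs (fun c => (x + (sumn (i :: c))%:R) ^+ 2)
             <= gmass qs * ((x + gmean qs + i%:R) ^+ 2 + gvar qs).
  rewrite (_ : x + gmean qs + i%:R = (x + i%:R) + gmean qs); last by ring.
  apply: le_trans (IH _ qs01); apply: ler_gsum => [|c _].
    by apply: sub_all qs01 => y /andP[].
  by rewrite /= natrD addrA.
apply: le_trans (ler_psum _ q0 IHi) _; rewrite psumZ.
rewrite [(1 - q)^-1 * _]mulrC -mulrA; apply: ler_wpM2l; first exact/ltW/gmass_gt0.
apply: le_trans (psum_sqr _ _ q01 v0) _.
by rewrite (_ : x + gmean qs + q / (1 - q) = x + (q / (1 - q) + gmean qs)) ?addrA //; ring.
Qed.

(** The sum is the product of the factors [(1 - q ^+ N.+1) / (1 - q)], and a product of numbers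
    [1 - eta_i] is at least [1] minus the sum of the [eta_i]. *)
Lemma gsum1_ge N qs (eta : R) : all (fun q => 0 <= q < 1) qs ->
  all (fun q => q ^+ N.+1 <= eta) qs ->
  gmass qs * (1 - (size qs)%:R * eta) <= gsum N qs (fun=> 1).
Proof.
elim: qs => [|q qs IH]; first by rewrite /gmass big_nil /= mul0r subr0 mulr1.
case/andP=> /andP[q0 q1] qs01 /andP[qe qse].
have qs1 : all (< 1) qs by apply: sub_all qs01 => y /andP[].
have W0 := gmass_gt0 qs1.
rewrite gsum_cons /gmass big_cons -/(gmass _) [size _]/=.
have -> : psum q N.+1 (fun=> gsum N qs (fun=> 1))
          = (1 - q ^+ N.+1) / (1 - q) * gsum N qs (fun=> 1).
  rewrite /psum -mulr_suml; congr (_ * _).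
  rewrite -[1 - q ^+ _]opprB subrX1 -mulNr opprB mulrC mulrA mulVf ?mul1r //.
  by rewrite subr_eq0 gt_eqF.
have qN0 : 0 <= q ^+ N.+1 by apply: exprn_ge0.
have qN1 : q ^+ N.+1 <= 1 by rewrite exprn_ile1 // ltW.
have p0 : 0 <= (1 - q)^-1 by rewrite invr_ge0 subr_ge0 ltW.
rewrite [X in _ <= X * _]mulrC -!mulrA; apply: ler_wpM2l => //.
apply: le_trans (_ : (1 - q ^+ N.+1) * (gmass qs * (1 - (size qs)%:R * eta)) <= _); last first.
  by apply: ler_wpM2l; [rewrite subr_ge0 | exact: IH].
rewrite mulrCA; apply: ler_wpM2l; first exact: ltW.
have : 0 <= (size qs)%:R * eta * q ^+ N.+1.
  by rewrite !mulr_ge0 // (le_trans qN0).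
rewrite -natr1; lra.
Qed.

(** By induction from [(1 - x) * (1 + (M + 1) * x) <= 1 + M * x]. It yields an explicit truncation
    level. *)
Lemma Bernoulli_inv q x M : 0 <= q -> q <= 1 - x -> 0 <= x ->
  q ^+ M * (1 + M%:R * x) <= 1.
Proof.
move=> q0 qx x0; elim: M => [|M IH]; first by rewrite expr0; lra.
apply: le_trans IH; rewrite exprSr -mulrA; apply: ler_wpM2l; first exact: exprn_ge0.
have M0 : 0 <= M%:R :> R by [].
rewrite -natr1; apply: le_trans (_ : (1 - x) * (1 + (M%:R + 1) * x) <= _).
  by apply: ler_wpM2r => //; nra.
have : 0 <= x ^+ 2 * (M%:R + 1) by rewrite mulr_ge0 ?sqr_ge0 //; lra.
lra.
Qed.

End GeometricSums.

(** * Expectations over independent letters and stationary averaging *)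

Section Expectation.
Context {R : realFieldType} {E : finType}.
Variable r : E -> R.
Hypothesis r_ge0 : forall e, 0 <= r e.
Hypothesis r_sum1 : \sum_e r e = 1.
Implicit Types (f g : seq E -> R).

Fixpoint expect (n : nat) f : R :=
  if n is m.+1 then \sum_e r e * expect m (fun s => f (e :: s)) else f [::].

Lemma ler_expect n f g : (forall s, size s = n -> f s <= g s) ->
  expect n f <= expect n g.
Proof.
elim: n f g => [|n IH] f g /= fg; first exact: fg.
apply: ler_sum => e _; apply: ler_wpM2l => //; apply: IH => s ss.
by apply: fg; rewrite /= ss.
Qed.

Lemma eq_expect n f g : (forall s, size s = n -> f s = g s) ->
  expect n f = expect n g.
Proof.
elim: n f g => [|n IH] f g /= fg; first exact: fg.
apply: eq_bigr => e _; congr (_ * _); apply: IH => s ss.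
by apply: fg; rewrite /= ss.
Qed.

Lemma expectD n f g : expect n (fun s => f s + g s) = expect n f + expect n g.
Proof.
elim: n f g => //= n IH f g; rewrite -big_split; apply: eq_bigr => e _.
by rewrite IH mulrDr.
Qed.

Lemma expectZ n a f : expect n (fun s => a * f s) = a * expect n f.
Proof.
elim: n f => //= n IH f; rewrite mulr_sumr; apply: eq_bigr => e _.
by rewrite IH mulrCA.
Qed.

Lemma expect_cst n a : expect n (fun=> a) = a.
Proof. by elim: n => //= n ->; rewrite -mulr_suml r_sum1 mul1r. Qed.

Lemma expect_ge0 n f : (forall s, 0 <= f s) -> 0 <= expect n f.
Proof. by move=> f0; rewrite -(expect_cst n 0); apply: ler_expect. Qed.

(** The count is binomial, so this is squared mean plus variance. The shift [x] carries the
    induction and later centres the count. *)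
Lemma expect_count n (A : pred E) x :
  let p := \sum_(e | A e) r e in
  expect n (fun s => (x + (count A s)%:R) ^+ 2)
  = (x + n%:R * p) ^+ 2 + n%:R * (p * (1 - p)).
Proof.
move=> p; elim: n x => [|n IH] x /=; first by rewrite !mul0r !addr0.
have Ap : \sum_(e | ~~ A e) r e = 1 - p.
  by rewrite -r_sum1 [in RHS](bigID A) /= -/p addrAC subrr add0r.
rewrite (bigID A) /=.
rewrite (eq_bigr (fun e => r e * ((x + 1 + n%:R * p) ^+ 2 + n%:R * (p * (1 - p))))).
  rewrite [X in _ + X](eq_bigr (fun e => r e * ((x + n%:R * p) ^+ 2 + n%:R * (p * (1 - p))))).
    by rewrite -!mulr_suml Ap -/p -natr1; ring.
  by move=> e /negbTE Ae; rewrite -IH Ae.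
by move=> e Ae; rewrite -IH Ae; congr (_ * _); apply: eq_expect => s _; rewrite natrD addrA.
Qed.

Section Stationary.
Variables (step : seq nat -> E -> seq nat) (qs : seq R).
Hypothesis qs_ge0 : all (>= 0) qs.
(** Invariance of the weights under one random step; the level rises by one because an arrival can
    lengthen a queue beyond [N]. *)
Hypothesis step_inv : forall N (f : seq nat -> R), (forall c, 0 <= f c) ->
  gsum N qs (fun c => \sum_e r e * f (step c e)) <= gsum N.+1 qs f.

Lemma gsum_foldl N n (f : seq nat -> R) : (forall c, 0 <= f c) ->
  gsum N qs (fun c => expect n (fun s => f (foldl step c s))) <= gsum (N + n) qs f.
Proof.
move=> f0; elim: n N => [|n IH] N; first by rewrite addn0.
rewrite addnS -addSn; apply: le_trans (IH _); rewrite [leLHS]/=.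
apply: (@step_inv N (fun c => expect n (fun s => f (foldl step c s)))) => c.
exact: expect_ge0.
Qed.

(** The bound on [Y] holds from every initial state, so it is averaged over the truncated weights
    and [gsum_foldl] carries them through the [n] steps. The truncated mass is at least half of
    [gmass], whence the factor 2. *)
Lemma queue_sqr_le (T n : nat) (Y : seq E -> nat) :
  all (fun q => q <= 1 - T%:R^-1) qs -> (0 < T)%N ->
  (forall c s, size c = size qs -> size s = n -> (Y s <= sumn (foldl step c s))%N) ->
  expect n (fun s => (Y s)%:R ^+ 2) <= 2 * (gmean qs ^+ 2 + gvar qs).
Proof.
move=> qsT T0 Yle; set m := size qs.
have T0' : 0 < T%:R^-1 :> R by rewrite invr_gt0 ltr0n.
have qs01 : all (fun q => 0 <= q < 1) qs.
  apply/allP => q qq; rewrite (allP qs_ge0) //=.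
  by apply: le_lt_trans (allP qsT _ qq) _; rewrite ltrBlDr ltrDl.
have W0 : 0 < gmass qs by apply: gmass_gt0; apply: sub_all qs01 => q /andP[].
(* With this level [Bernoulli_inv] at [x = 1 / T] gives [q ^+ N <= 1 / (1 + 2 * m) = eta], and
   [m * eta <= 1 / 2]. *)
pose N := (2 * m * T)%N; set e := expect _ _; pose eta : R := (1 + (2 * m)%:R)^-1.
have D0 : 0 < 1 + (2 * m)%:R :> R by rewrite ltr_wpDr.
have qeta : all (fun q => q ^+ N.+1 <= eta) qs.
  apply/allP => q qq; have /andP[q0 q1] := allP qs01 _ qq.
  apply: le_trans (_ : q ^+ N <= _).
    by rewrite exprS -[leRHS]mul1r ler_wpM2r ?exprn_ge0 // ltW.
  rewrite /eta -[leRHS]mul1r ler_pdivlMr //.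
  apply: le_trans (Bernoulli_inv N q0 (allP qsT _ qq) (ltW T0')).
  apply: ler_wpM2l; first exact: exprn_ge0.
  by rewrite lerD2l /N [(2 * m * T)%:R]natrM mulfK // pnatr_eq0 -lt0n.
have Wge := gsum1_ge qs01 qeta.
have half : gmass qs * 2^-1 <= gsum N qs (fun=> 1).
  apply: le_trans Wge; apply: ler_wpM2l; first exact: ltW.
  have : (m%:R : R) * eta <= 2^-1.
    by rewrite /eta ler_pdivrMr // natrM; lra.
  by rewrite -/m; lra.
have e0 : 0 <= e by apply: expect_ge0 => s; rewrite sqr_ge0.
have main : e * gsum N qs (fun=> 1) <= gmass qs * (gmean qs ^+ 2 + gvar qs).
  rewrite -gsumZ.
  apply: le_trans (_ : gsum (N + n) qs (fun c => (sumn c)%:R ^+ 2) <= _); last first.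
    apply: le_trans (_ : gsum (N + n) qs (fun c => (0 + (sumn c)%:R) ^+ 2) <= _).
      by apply: ler_gsum => // c _; rewrite add0r.
    by apply: le_trans (gsum_sqr _ _ qs01) _; rewrite add0r.
  apply: le_trans (gsum_foldl N n (f := fun c => (sumn c)%:R ^+ 2) _); last first.
    by move=> c; rewrite sqr_ge0.
  apply: ler_gsum => // c cs; rewrite mulr1; apply: ler_expect => s ss.
  by rewrite lerXn2r ?nnegrE ?ler_nat // Yle.
have := le_trans (ler_wpM2l e0 half) main.
rewrite mulrCA ler_pM2l // => H; lra.
Qed.

End Stationary.
End Expectation.

(** * Words as sequences of independent letters, and independent marks *)

Lemma word_sum_expect (R : realFieldType) (d n : nat) (alpha : 'I_d -> R) (k : 'I_d)
    (F : word d n -> R) :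
  \sum_(w : word d n) word_prob alpha w * F w
  = expect alpha n (fun s => F [ffun i : 'I_n => nth k s i]).
Proof.
elim: n F => [|n IH] F /=.
  rewrite (big_pred1 [ffun i => k]); last first.
    by move=> w; symmetry; apply/eqP/ffunP => -[].
  rewrite /word_prob big_ord0 mul1r; congr F; apply/ffunP => -[] //.
pose cons_word (p : 'I_d * word d n) : word d n.+1 :=
  [ffun i => if unlift ord0 i is Some j then p.2 j else p.1].
pose uncons (w : word d n.+1) : 'I_d * word d n :=
  (w ord0, [ffun j => w (lift ord0 j)]).
have K1 : cancel cons_word uncons.
  move=> [x w]; rewrite /uncons /cons_word !ffunE unlift_none; congr (_, _).
  by apply/ffunP => j; rewrite !ffunE liftK.
have K2 : cancel uncons cons_word.
  move=> w; apply/ffunP => i; rewrite ffunE.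
  by case: unliftP => [j ->|->] //=; rewrite ffunE.
rewrite (reindex cons_word) /=; last by exists uncons => x _; [apply: K1 | apply: K2].
rewrite -(pair_bigA _ (fun x w => word_prob alpha (cons_word (x, w)) * F (cons_word (x, w)))) /=.
apply: eq_bigr => x _.
transitivity (alpha x * \sum_w word_prob alpha w * F (cons_word (x, w))).
  rewrite mulr_sumr; apply: eq_bigr => w _; rewrite mulrA; congr (_ * _).
  rewrite /word_prob big_ord_recl ffunE unlift_none; congr (_ * _).
  by apply: eq_bigr => j _; rewrite ffunE liftK.
congr (_ * _); rewrite IH; apply: eq_expect => s ss; congr F.
by apply/ffunP => i; rewrite !ffunE; case: unliftP => [j ->|->] //=; rewrite ffunE.
Qed.

Definition coin (R : realFieldType) (E : finType) (r kappa : E -> R) (e : E * bool) : R :=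
  r e.1 * (if e.2 then kappa e.1 else 1 - kappa e.1).

Section Coin.
Context {R : realFieldType} {E : finType}.
Variables r kappa : E -> R.

Lemma sum_coin (P : pred (E * bool)) (F : E * bool -> R) :
  \sum_(e | P e) F e =
  \sum_e ((if P (e, true) then F (e, true) else 0)
          + (if P (e, false) then F (e, false) else 0)).
Proof.
transitivity (\sum_e \sum_b (if P (e, b) then F (e, b) else 0)).
  by rewrite pair_bigA big_mkcond; apply: eq_bigr => -[].
by apply: eq_bigr => e _; rewrite big_bool.
Qed.

Lemma coin_ge0 : (forall e, 0 <= r e) -> (forall e, 0 <= kappa e <= 1) ->
  forall e, 0 <= coin r kappa e.
Proof.
move=> r0 k01 [e b]; have /andP[k0 k1] := k01 e.
by rewrite /coin mulr_ge0 //; case: b => //=; rewrite subr_ge0.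
Qed.

Lemma coin_sum1 : \sum_e r e = 1 -> \sum_e coin r kappa e = 1.
Proof.
by move=> r1; rewrite sum_coin -r1; apply: eq_bigr => e _; rewrite /coin /=; ring.
Qed.

(** Summing out the marks restores the law of the letters, so marks can be introduced into any
    expectation. *)
Lemma expect_coin n (f : seq E -> R) :
  expect (coin r kappa) n (fun s => f (map fst s)) = expect r n f.
Proof.
elim: n f => //= n IH f; rewrite sum_coin; apply: eq_bigr => e _ /=.
by rewrite !(IH (fun s => f (e :: s))) /coin /=; ring.
Qed.

End Coin.

Lemma sum_ord_gt (R : nmodType) (d k : nat) (F : nat -> R) :
  \sum_(j < d | (k < j)%N) F j = \sum_(i < d - k.+1) F (i + k.+1)%N.
Proof.
rewrite (eq_bigl (fun j : 'I_d => true && (k < j)%N)) //.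
by rewrite -(big_geq_mkord _ _ xpredT F) -{1}[k.+1]add0n big_addn big_mkord.
Qed.

Lemma sum_ord_lt (R : nmodType) (d k : nat) (F : nat -> R) : (k <= d)%N ->
  \sum_(j < d | (j < k)%N) F (k - j.+1)%N = \sum_(i < k) F i.
Proof.
move=> kd; rewrite -(big_ord_widen d (fun j => F (k - j.+1)%N) kd).
by rewrite [RHS](reindex_inj rev_ord_inj).
Qed.

(** * Moments in terms of the rates, and elementary inequalities *)

Section QueueMoments.
Context {R : realFieldType}.
Implicit Types rs : seq R.

(** For [q = r / b] the mean [q / (1 - q)] is [r / (b - r)], and the gap [b - r] is at least
    [de]. *)
Lemma gmean_map_le (b de : R) rs : 0 < de -> all (fun r => 0 <= r <= b - de) rs ->
  gmean [seq r / b | r <- rs] <= (\sum_(r <- rs) r) / de.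
Proof.
move=> de0 Hr; rewrite /gmean big_map mulr_suml !big_seq; apply: ler_sum => r rr.
have /andP[r0 rb] := allP Hr _ rr.
have b0 : 0 < b by lra.
have br : 0 < b - r by lra.
have -> : r / b / (1 - r / b) = r / (b - r) by field; rewrite !lt0r_neq0.
by apply: ler_wpM2l => //; rewrite lef_pV2 ?posrE //; lra.
Qed.

Lemma gvar_map_le (b de : R) rs : 0 < de -> all (fun r => 0 <= r <= b - de) rs ->
  gvar [seq r / b | r <- rs] <= (\sum_(r <- rs) r) * b / de ^+ 2.
Proof.
move=> de0 Hr; rewrite /gvar big_map !mulr_suml !big_seq; apply: ler_sum => r rr.
have /andP[r0 rb] := allP Hr _ rr.
have b0 : 0 < b by lra.
have br : 0 < b - r by lra.
have -> : r / b / (1 - r / b) ^+ 2 = r * b / (b - r) ^+ 2.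
  by field; rewrite !lt0r_neq0.
apply: ler_wpM2l; first by rewrite mulr_ge0 // ltW.
by rewrite lef_pV2 ?posrE ?exprn_gt0 // lerXn2r ?nnegrE; lra.
Qed.

(** Dividing by [b <= 1] can only widen the gap [x]. *)
Lemma map_div_le (b x : R) rs : 0 < b <= 1 -> 0 <= x ->
  all (fun r => 0 <= r <= b - x) rs ->
  all (fun q => q <= 1 - x) [seq r / b | r <- rs].
Proof.
case/andP=> b0 b1 x0 Hr; rewrite all_map; apply: sub_all Hr => r /= /andP[r0 rb].
rewrite ler_pdivrMr //; nra.
Qed.

(** An ordered field may have no square roots, so the integer part of the root is used; [M] bounds
    the candidates, as the field may be non-Archimedean. *)
Lemma nat_sqrt (x : R) (M : nat) : 0 <= x <= M%:R ->
  exists s : nat, (s%:R ^+ 2 <= x) && (x < (s.+1)%:R ^+ 2).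
Proof.
case/andP=> x0 xM.
have ex0 : exists s, s%:R ^+ 2 <= x by exists 0%N; rewrite expr0n.
have ub s : s%:R ^+ 2 <= x -> (s <= M)%N.
  move=> sx; have : (s ^ 2)%:R <= M%:R :> R by rewrite natrX; apply: le_trans xM.
  by rewrite ler_nat; apply: leq_trans; rewrite -{1}(expn1 s); case: s {sx} => // s; rewrite leq_pexp2l.
case: (ex_maxnP ex0 ub) => s sx smax; exists s; rewrite sx ltNge.
by apply/negP => /smax; rewrite ltnn.
Qed.

Lemma sqr_max0_le (x y : R) : x <= y -> Num.max 0 x ^+ 2 <= y ^+ 2.
Proof.
move=> xy; have [x0|x0] := leP x 0; first by rewrite expr0n sqr_ge0.
by rewrite lerXn2r ?nnegrE //; lra.
Qed.

Lemma sqr_add3_le (x y z : R) : (x + y + z) ^+ 2 <= 3 * (x ^+ 2 + y ^+ 2 + z ^+ 2).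
Proof. by have := sqr_ge0 (x - y); have := sqr_ge0 (y - z); have := sqr_ge0 (x - z); nra. Qed.

Lemma sqr_max0_split (x : R) : x ^+ 2 <= Num.max 0 x ^+ 2 + Num.max 0 (- x) ^+ 2.
Proof.
have [x0|x0] := leP 0 x; first by rewrite lerDl sqr_ge0.
by rewrite expr0n add0r max_r ?sqrrN // oppr_ge0 ltW.
Qed.

End QueueMoments.

(** * Second moments of the excess and of the deficit of a row *)

Section Rows.
Context {R : realFieldType} {d : nat}.
Variables (alpha : 'I_d -> R) (k : 'I_d) (n : nat).
Hypothesis alpha_ge0 : forall i : 'I_d, 0 <= alpha i.
Hypothesis alpha_sum1 : \sum_(i : 'I_d) alpha i = 1.
Hypothesis alpha_sorted : forall i j : 'I_d, (i <= j)%N -> alpha j <= alpha i.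

Let a := alpha k.
Let p := \sum_(j : 'I_d | (k <= j)%N) alpha j.

Let tail_split : p = a + \sum_(j : 'I_d | (k < j)%N) alpha j.
Proof.
rewrite /p (bigD1 k) //=; congr (_ + _); apply: eq_bigl => j.
by rewrite ltn_neqAle andbC eq_sym.
Qed.

Let head_split : \sum_(j : 'I_d | (j < k)%N) alpha j = 1 - p.
Proof.
rewrite -alpha_sum1 [in RHS](bigID (fun j : 'I_d => (k <= j)%N)) /= -/p addrAC subrr add0r.
by apply: eq_bigl => j; rewrite ltnNge.
Qed.

Let p_le1 : p <= 1.
Proof. by rewrite -subr_ge0 -head_split sumr_ge0. Qed.

Let a_le_p : a <= p.
Proof. by rewrite tail_split lerDl sumr_ge0. Qed.

Let a_ge0 : 0 <= a. Proof. exact: alpha_ge0. Qed.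

(** * Stationarity of the marked system for the upper bound *)

Section UpperStep.
Variable eps : R.
Hypothesis eps01 : 0 <= eps <= 1.
(** The total weight of the signalling letters: [k] itself and the marked letters above it. *)
Let b := a + eps * (p - a).
Hypothesis b_gt0 : 0 < b.
Let flip := coin alpha (fun=> eps).
(** The weight of the unmarked letter [i], extended by 0 outside the alphabet; the indices used in
    [rs] stay inside it. *)
Let rate (i : nat) : R := oapp alpha 0 (insub i) * (1 - eps).
Let rs : seq R := mkseq (fun i => rate (i + k.+1)) (d - k.+1).

Lemma upper_rates_sum : \sum_(r <- rs) r = (1 - eps) * (p - a).
Proof.
rewrite /rs big_map -{1}[(d - _)%N]subn0 big_mkord.
rewrite -(sum_ord_gt d k rate) tail_split [a + _]addrC addrK mulr_sumr.
by apply: eq_bigr => j _; rewrite /rate valK /= mulrC.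
Qed.

(** From [alpha j <= a] above [k]: [b - (1 - eps) * alpha j >= eps * a + eps * (p - a) = eps *
    p]. *)
Lemma upper_rates_le : all (fun r => 0 <= r <= b - eps * p) rs.
Proof.
have /andP[e0 e1] := eps01.
apply/allP => r /mapP[i _ ->]; rewrite /rate.
case: insubP => [j _ jE|_] /=; last first.
  rewrite mul0r lexx /b; have := mulr_ge0 (_ : 0 <= 1 - eps) a_ge0; lra.
have aj : alpha j <= a by apply: alpha_sorted; rewrite jE; lia.
rewrite mulr_ge0 //=; last by lra.
have : 0 <= (1 - eps) * (a - alpha j) by rewrite mulr_ge0 //; lra.
by rewrite /b; lra.
Qed.

(** Letters below [k] leave the state alone with weight [1 - p]; signals and pushes are balanced by
    [gsum_push], and the weights sum to 1. *)
Lemma upper_step_inv N (f : seq nat -> R) : (forall c, 0 <= f c) ->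
  gsum N [seq r / b | r <- rs] (fun c => \sum_e flip e * f (upper_step k c e))
  <= gsum N.+1 [seq r / b | r <- rs] f.
Proof.
move=> f0; set qs := [seq _ | _ <- rs]; have /andP[e0 e1] := eps01.
have rs0 : all (>= 0) rs by apply: sub_all upper_rates_le => r /andP[].
have qs0 : all (>= 0) qs.
  by rewrite all_map; apply: sub_all rs0 => x /= x0; rewrite divr_ge0 // ltW.
have E c : \sum_e flip e * f (upper_step k c e)
    = (1 - p) * f c + b * f (signal c) + \sum_(i < size rs) rs`_i * f (push i c).
  have -> : \sum_(i < size rs) rs`_i * f (push i c)
          = \sum_(j : 'I_d | (k < j)%N) alpha j * (1 - eps) * f (push (j - k.+1) c).
    transitivity (\sum_(i < d - k.+1) rate (i + k.+1) * f (push (i + k.+1 - k.+1) c)).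
      rewrite /rs size_mkseq; apply: eq_bigr => i _.
      by rewrite nth_mkseq // addnK.
    rewrite -(sum_ord_gt d k (fun j => rate j * f (push (j - k.+1) c))).
    by apply: eq_bigr => j _; rewrite /rate valK.
  rewrite -head_split /b tail_split [a + _ - a]addrAC subrr add0r mulrDl mulr_sumr !mulr_suml.
  rewrite sum_coin (bigID (fun j : 'I_d => (j < k)%N)) /=.
  rewrite -!addrA; congr (_ + _).
    by apply: eq_bigr => j jk; rewrite /flip /coin /upper_step /= jk; ring.
  rewrite (bigD1 k) ?ltnn //=; congr (_ + _).
    by rewrite /flip /coin /upper_step /= ltnn eqxx /= /a; ring.
  rewrite -big_split; apply: eq_big => j.
    by rewrite -leqNgt ltn_neqAle andbC eq_sym.
  case/andP=> jk jnk; rewrite /flip /coin /upper_step /= (negbTE jk) (negbTE jnk) /=; ring.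
under eq_gsum do rewrite E.
rewrite !gsumD !gsumZ.
have := gsum_sum (index_enum 'I_(size rs)) xpredT (fun i => rs`_i)
  (fun i c => f (push i c)) N qs.
move=> ->; have := gsum_push N b_gt0 rs0 f0; cbv zeta; rewrite -/qs.
have -> : \sum_(i < size rs) rs`_i = (1 - eps) * (p - a).
  by rewrite -upper_rates_sum (big_nth 0) big_mkord.
have : (1 - p) * gsum N qs f <= (1 - p) * gsum N.+1 qs f.
  by apply: ler_wpM2l; [rewrite subr_ge0 | apply: gsum_leS].
rewrite /b; lra.
Qed.

End UpperStep.

(** The row is at most the number of letters from [k] on, with second moment at most
    [(p * n) ^+ 2 + p * n]. *)
Lemma row_upper_small : p * n%:R <= 16 ->
  expect alpha n (fun s => Num.max 0 ((rsk_row k s)%:R - a * n%:R) ^+ 2) <= 17 * (p * n%:R).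
Proof.
move=> small; have an0 : 0 <= a * n%:R by rewrite mulr_ge0.
apply: le_trans (_ : expect alpha n
    (fun s => (0 + (count (fun j : 'I_d => k <= j)%N s)%:R) ^+ 2) <= _).
  apply: ler_expect => // s _; apply: sqr_max0_le.
  have : (rsk_row k s)%:R <= (count (fun j : 'I_d => k <= j)%N s)%:R :> R.
    by rewrite ler_nat row_le_count.
  by lra.
rewrite (expect_count alpha_sum1) -/p add0r.
have x0 : 0 <= p * n%:R by rewrite mulr_ge0 // (le_trans a_ge0).
have H1 : (p * n%:R) * (p * n%:R) <= 16 * (p * n%:R) by apply: ler_wpM2r.
have H2 : 0 <= (p * n%:R) * p by rewrite mulr_ge0 // (le_trans a_ge0).
by clearbody p; nra.
Qed.

(** The excess splits into the fluctuation of the number of letters [k], twice the number of marked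
    letters, and a queue part [Y]. The last two have second moments of order [t ^+ 2] and
    [(p / de) ^+ 2], both of order [p * n]. *)
Lemma row_upper_large : 16 <= p * n%:R ->
  expect alpha n (fun s => Num.max 0 ((rsk_row k s)%:R - a * n%:R) ^+ 2)
  <= 3 * (a * n%:R) + 34 * (p * n%:R).
Proof.
move=> large; have p0 : 0 <= p by apply: le_trans a_ge0 a_le_p.
have n0' : 0 <= n%:R :> R by [].
have pn_n : p * n%:R <= n%:R by rewrite ler_piMl.
have [|t /andP[t_le t_gt]] := @nat_sqrt R (p * n%:R) n.
  by rewrite pn_n mulr_ge0.
(* This is where 16 enters: [t >= 4] gives [t + 1 <= 5 / 4 * t], so rounding the root costs at most
   a factor [25 / 16]. *)
have t4 : (4 <= t)%N.
  rewrite leqNgt; apply/negP => t4; have : (t.+1 ^ 2)%:R <= 16 :> R.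
    by rewrite ler_nat (@leq_exp2r _ 4 2).
  by rewrite natrX => H; move: (lt_le_trans t_gt H); rewrite ltNge large.
have t4R : 4 <= t%:R :> R by rewrite ler_nat.
have n_gt0 : 0 < n%:R :> R by apply: lt_le_trans pn_n; apply: lt_le_trans large.
have p_gt0 : 0 < p.
  by rewrite -(pmulr_lgt0 _ n_gt0); apply: lt_le_trans large.
(* The gap of the rates is at least [de = t / n], about [sqrt (p / n)]. *)
pose eps := t%:R / (n%:R * p); pose de := eps * p.
have epsE : de * n%:R = t%:R by rewrite /de /eps; field; rewrite !lt0r_neq0.
have np_gt0 : 0 < n%:R * p by rewrite mulr_gt0.
have eps01 : 0 <= eps <= 1.
  rewrite /eps divr_ge0 ?(ltW np_gt0) //= ler_pdivrMr // mul1r [n%:R * p]mulrC.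
  by apply: le_trans t_le; nra.
have /andP[e0 e1] := eps01.
have de_gt0 : 0 < de by rewrite -(pmulr_lgt0 _ n_gt0) epsE; lra.
pose b := a + eps * (p - a).
have b_ge : de <= b.
  by rewrite /b /de; have := mulr_ge0 (_ : 0 <= 1 - eps) a_ge0; lra.
have b_le : b <= p.
  by rewrite /b; have : 0 <= (1 - eps) * (p - a); [rewrite mulr_ge0 ?subr_ge0|lra].
have b_gt0 : 0 < b by apply: lt_le_trans b_ge.
set r := coin alpha (fun=> eps).
have r0 : forall e, 0 <= r e by apply: coin_ge0.
have r1 : \sum_e r e = 1 by apply: coin_sum1.
pose A1 (e : 'I_d * bool) := e.1 == k.
pose A2 (e : 'I_d * bool) := e.2 && (k < e.1)%N.
pose Y s := (rsk_row k (map fst s) - (count A1 s + 2 * count A2 s))%N.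
rewrite -(expect_coin alpha (fun=> eps)).
(* The 12 is [3 * 2 ^ 2], as the marked letters are counted twice. *)
apply: le_trans (_ : expect r n (fun s => 3 * (- (a * n%:R) + (count A1 s)%:R) ^+ 2
    + (12 * (0 + (count A2 s)%:R) ^+ 2 + 3 * (Y s)%:R ^+ 2)) <= _).
  apply: ler_expect => // s _.
  have H : (rsk_row k (map fst s))%:R <=
      (count A1 s)%:R + 2 * (count A2 s)%:R + (Y s)%:R :> R.
    by rewrite -natrM -!natrD ler_nat -leq_subLR.
  apply: le_trans (sqr_max0_le (y := (- (a * n%:R) + (count A1 s)%:R)
     + 2 * (count A2 s)%:R + (Y s)%:R) _) _; first by lra.
  by apply: le_trans (sqr_add3_le _ _ _) _; rewrite add0r; nra.
rewrite !expectD !expectZ !(expect_count r1).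
have p1E : \sum_(e | A1 e) r e = a.
  rewrite sum_coin (bigD1 k) //= big1 ?addr0; last first.
    by move=> j /negbTE jk; rewrite /A1 /= jk addr0.
  by rewrite /A1 /= eqxx /r /coin /= /a; ring.
have p2E : \sum_(e | A2 e) r e = eps * (p - a).
  rewrite sum_coin tail_split [a + _]addrC addrK mulr_sumr [RHS]big_mkcond /=.
  by apply: eq_bigr => j _; rewrite /A2 /r /coin /= addr0 mulrC.
rewrite p1E p2E.
pose rate (i : nat) : R := oapp alpha 0 (insub i) * (1 - eps).
pose rs : seq R := mkseq (fun i => rate (i + k.+1)%N) (d - k.+1).
have rs_le : all (fun x => 0 <= x <= b - de) rs by apply: upper_rates_le.
have rs_sum : \sum_(x <- rs) x = (1 - eps) * (p - a) by apply: upper_rates_sum.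
have rs_sum_le : \sum_(x <- rs) x <= p.
  rewrite rs_sum; have : 0 <= eps * (p - a) by rewrite mulr_ge0 // subr_ge0.
  by have := a_ge0; lra.
have YE : expect r n (fun s => (Y s)%:R ^+ 2)
   <= 2 * (gmean [seq x / b | x <- rs] ^+ 2 + gvar [seq x / b | x <- rs]).
  have qs0 : all (>= 0) [seq x / b | x <- rs].
    rewrite all_map; apply: sub_all rs_le => x /= /andP[x0 _].
    by rewrite divr_ge0 // ltW.
  apply: (@queue_sqr_le R _ r r0 r1 (upper_step k) _ qs0 _ n n Y).
  - by move=> N f f0; apply: upper_step_inv.
  (* The ratios are at most [1 - de], and [de = t / n >= 1 / n], so [T = n] is admissible. *)
  - have := @map_div_le R b de rs; rewrite b_gt0 (le_trans b_le p_le1) => /(_ isT).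
    move=> /(_ (ltW de_gt0) rs_le); apply: sub_all => q /le_trans; apply.
    rewrite lerD2l lerN2 -[n%:R^-1]mul1r ler_pdivrMr // epsE.
    by apply: le_trans t4R; rewrite ler1n.
  - by rewrite -(ltr_nat R).
  - move=> c s cs _; rewrite /Y leq_subLR; apply: row_le_queue.
    by rewrite cs size_map size_mkseq.
have mean_le := gmean_map_le de_gt0 rs_le.
have var_le := gvar_map_le de_gt0 rs_le.
pose z := p / de.
have z0 : 0 <= z by rewrite divr_ge0 // ltW.
have mean2 : gmean [seq x / b | x <- rs] ^+ 2 <= z ^+ 2.
  have g0 : 0 <= gmean [seq x / b | x <- rs].
    rewrite /gmean big_map big_seq sumr_ge0 // => x xr.
    have /andP[x0 xb] := allP rs_le _ xr.
    rewrite divr_ge0 ?divr_ge0 // ?ltW // subr_gt0 ltr_pdivrMr //; lra.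
  rewrite lerXn2r ?nnegrE //; apply: le_trans mean_le _.
  by rewrite ler_wpM2r // invr_ge0 ltW.
have var2 : gvar [seq x / b | x <- rs] <= z ^+ 2.
  apply: le_trans var_le _; rewrite /z expr_div_n ler_wpM2r ?invr_ge0 ?sqr_ge0 //.
  have S0 : 0 <= \sum_(x <- rs) x.
    by rewrite rs_sum mulr_ge0 ?subr_ge0.
  by rewrite expr2 ler_pM // ltW.
have z2 : z ^+ 2 * 16 <= 25 * (p * n%:R).
  have zt : z * t%:R = p * n%:R by rewrite -epsE /z; field; rewrite lt0r_neq0.
  have t1 : (t.+1)%:R <= 5 / 4 * t%:R :> R by rewrite -natr1; lra.
  have t2 : p * n%:R <= (5 / 4 * t%:R) ^+ 2.
    by apply: le_trans (ltW t_gt) _; rewrite lerXn2r ?nnegrE //; lra.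
  have tt0 : 0 < t%:R ^+ 2 :> R by rewrite exprn_gt0 //; lra.
  rewrite -(ler_pM2r tt0).
  have -> : z ^+ 2 * 16 * t%:R ^+ 2 = (p * n%:R) ^+ 2 * 16 by rewrite -zt; ring.
  have := ler_wpM2l (mulr_ge0 p0 n0') t2.
  by rewrite expr2; lra.
have ch : n%:R * (eps * (p - a)) <= t%:R.
  rewrite -epsE /de [_ * n%:R]mulrC; apply: ler_wpM2l => //.
  by apply: ler_wpM2l => //; rewrite gerBl.
have ch0 : 0 <= n%:R * (eps * (p - a)) by rewrite mulr_ge0 // mulr_ge0 // subr_ge0.
have ch2 : (0 + n%:R * (eps * (p - a))) ^+ 2 <= t%:R ^+ 2.
  by rewrite add0r lerXn2r ?nnegrE.
have ch3 : n%:R * (eps * (p - a) * (1 - eps * (p - a))) <= t%:R.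
  apply: le_trans ch; apply: ler_wpM2l => //; rewrite ler_piMr // ?gerBl.
    by rewrite mulr_ge0 // subr_ge0.
  by rewrite mulr_ge0 // subr_ge0.
have tt : t%:R * 4 <= p * n%:R.
  by apply: le_trans t_le; rewrite expr2; apply: ler_wpM2l.
have -> : - (a * n%:R) + n%:R * a = 0 by ring.
have a1 : n%:R * (a * (1 - a)) <= a * n%:R.
  by rewrite mulrC ler_wpM2r // ler_piMr // gerBl.
rewrite expr0n add0r.
(* The coefficient of [p * n] is [12 * (1 + 1 / 4)] from the marked letters plus [3 * 4 * 25 / 16]
   from the queues, in all [135 / 4 <= 34]. *)
by move: (expect _ _ _) YE => e YE; lra.
Qed.

Lemma row_upper :
  expect alpha n (fun s => Num.max 0 ((rsk_row k s)%:R - a * n%:R) ^+ 2)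
  <= 3 * (a * n%:R) + 34 * (p * n%:R).
Proof.
have [/ltW large|/row_upper_small small] := ltP 16 (p * n%:R); first exact: row_upper_large.
apply: le_trans small _; have : 0 <= a * n%:R by rewrite mulr_ge0.
have : 0 <= p * n%:R by rewrite mulr_ge0 // (le_trans a_ge0).
lra.
Qed.

(** * Stationarity of the thinned system for the lower bound *)

Section LowerStep.
Variable l : R.
Hypothesis l_bounds : 0 <= l <= a.
Hypothesis a_gt0 : 0 < a.
(** Thinning gives each letter below [k] the weight [a] exactly and the letter [k] the weight [l],
    so all queues share the ratio [l / a]. *)
Let keep (j : 'I_d) : R :=
  if (j < k)%N then a / alpha j else if j == k then l / a else 0.
Let thin := coin alpha keep.

Let a_le (j : 'I_d) : (j <= k)%N -> a <= alpha j.
Proof. exact: alpha_sorted. Qed.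

Lemma keep01 j : 0 <= keep j <= 1.
Proof.
have /andP[l0 la] := l_bounds; rewrite /keep.
case: ifP => [jk|_].
  have aj : a <= alpha j by apply/a_le/ltnW.
  have aj0 : 0 < alpha j by apply: lt_le_trans aj.
  by rewrite divr_ge0 ?ler_pdivrMr ?mul1r.
case: ifP => _; last by rewrite lexx ler01.
by rewrite divr_ge0 ?ler_pdivrMr ?mul1r.
Qed.

Lemma lower_step_inv N (f : seq nat -> R) : (forall c, 0 <= f c) ->
  gsum N (nseq k (l / a)) (fun c => \sum_e thin e * f (lower_step k c e))
  <= gsum N.+1 (nseq k (l / a)) f.
Proof.
move=> f0; have /andP[l0 la] := l_bounds; set qs := nseq _ _.
have qs0 : all (>= 0) qs by rewrite all_nseq divr_ge0 ?orbT // ltW.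
have E c : \sum_e thin e * f (lower_step k c e)
    = (1 - (l + a *+ k)) * f c + l * f (arrive c) + \sum_(i < k) a * f (serve i c).
  (* In terms of increments the ignored letters contribute zero. *)
  transitivity (f c + \sum_e thin e * (f (lower_step k c e) - f c)).
    under [in RHS]eq_bigr do rewrite mulrBr.
    by rewrite big_split /= sumrN -mulr_suml coin_sum1 // mul1r [RHS]addrC subrK.
  have -> : \sum_e thin e * (f (lower_step k c e) - f c)
     = l * (f (arrive c) - f c) + \sum_(i < k) a * (f (serve i c) - f c).
    rewrite -(sum_ord_lt (fun i => a * (f (serve i c) - f c)) (ltnW (ltn_ord k))).
    rewrite sum_coin (bigD1 k) //= (bigID (fun j : 'I_d => (j < k)%N)) /=.
    rewrite [X in _ + (_ + X)]big1 ?addr0 => [|j /andP[/negbTE jk /negbTE jnk]]; last first.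
      rewrite /thin /coin /keep /lower_step /= jnk jk.
      by rewrite leq_eqVlt jnk orbF (_ : (nat_of_ord j == k) = false) //= subrr !mulr0 addr0.
    congr (_ + _).
      rewrite /thin /coin /keep /lower_step /= leqnn ltnn eqxx subrr mulr0 addr0.
      by congr (_ * _); rewrite -/a mulrC divfK ?gt_eqF.
    apply: eq_big => j; first by case: (ltnP j k) => jk; rewrite ?andbF // andbT -val_eqE neq_ltn jk.
    case/andP=> /negbTE jk jlt.
    rewrite /thin /coin /keep /lower_step /= jlt (ltnW jlt) jk subrr mulr0 addr0.
    congr (_ * _); rewrite mulrC divfK // gt_eqF //.
    by apply: lt_le_trans a_gt0 _; apply/a_le/ltnW.
  under eq_bigr do rewrite mulrBr.
  rewrite big_split /= sumrN sumr_const card_ord -mulrnAl; ring.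
under eq_gsum do rewrite E.
rewrite !gsumD !gsumZ.
have -> := gsum_sum (index_enum 'I_k) xpredT (fun=> a) (fun i c => f (serve i c)) N qs.
have := gsum_serve N k l0 a_gt0 f0; cbv zeta; rewrite -/qs.
(* The [k] letters below [k] weigh at least [a] each and [1 - p] together, while [l <= a <= p]. *)
have h0 : 0 <= 1 - (l + a *+ k).
  have : a *+ k <= 1 - p.
    have <- : \sum_(j < d | (j < k)%N) a = a *+ k.
      by rewrite (sum_ord_lt (fun=> a) (ltnW (ltn_ord k))) sumr_const card_ord.
    by rewrite -head_split; apply: ler_sum => j /ltnW/a_le.
  by move: a_le_p; lra.
have := ler_wpM2l h0 (gsum_leS N qs0 f0).
lra.
Qed.

End LowerStep.

(** The deficit never exceeds [a * n], one factor of whose square is at most [k + 1] here. *)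
Lemma row_lower_small : a * n%:R <= k.+1%:R ->
  expect alpha n (fun s => Num.max 0 (a * n%:R - (rsk_row k s)%:R) ^+ 2)
  <= k.+1%:R * (a * n%:R).
Proof.
move=> small; have an0 : 0 <= a * n%:R by rewrite mulr_ge0.
apply: le_trans (_ : expect alpha n (fun=> (a * n%:R) ^+ 2) <= _).
  apply: ler_expect => // s _; apply: sqr_max0_le.
  by rewrite gerBl.
by rewrite expect_cst // expr2 ler_wpM2r.
Qed.

(** The deficit splits into the fluctuation of the number of marked letters [k], the lost mean
    [t = de * n], and a queue part [Y] with mean of order [k * a / de]. *)
Lemma row_lower_large : k.+1%:R <= a * n%:R ->
  expect alpha n (fun s => Num.max 0 (a * n%:R - (rsk_row k s)%:R) ^+ 2)
  <= 27 * (k.+1%:R * (a * n%:R)).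
Proof.
move=> large; set K : R := k.+1%:R in large *.
have KE : K = k%:R + 1 by rewrite /K -natr1.
have K1 : 1 <= K by rewrite /K ler1n.
have KM : K * n%:R = (k.+1 * n)%:R by rewrite /K natrM.
clearbody K.
have n0' : 0 <= n%:R :> R by [].
have a1 : a <= 1 by apply: le_trans a_le_p p_le1.
have an_gt0 : 0 < a * n%:R by apply: lt_le_trans large; lra.
have an_n : a * n%:R <= n%:R by rewrite ler_piMl.
have n_gt0 : 0 < n%:R :> R by apply: lt_le_trans an_n.
have a_gt0 : 0 < a by rewrite -(pmulr_lgt0 _ n_gt0).
have [|t /andP[t_le t_gt]] := @nat_sqrt R (K * (a * n%:R)) (k.+1 * n).
  rewrite mulr_ge0 ?(ltW an_gt0) ?(le_trans ler01 K1) //=.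
  by rewrite -KM ler_wpM2l //; lra.
have Kan1 : 1 <= K * (a * n%:R) by rewrite -[1]mulr1 ler_pM //; lra.
have t1 : (1 <= t)%N.
  case: t t_gt {t_le} => // H; move: H.
  by rewrite expr1n ltNge Kan1.
have t1R : 1 <= t%:R :> R by rewrite ler1n.
(* The assumption [K <= a * n] gives [t ^+ 2 <= K * (a * n) <= (a * n) ^+ 2]; hence [de <= a] and
   [l] is nonnegative. *)
have t_an : t%:R <= a * n%:R.
  have : t%:R ^+ 2 <= (a * n%:R) ^+ 2.
    by apply: le_trans t_le _; rewrite expr2 ler_wpM2r // ltW.
  by rewrite ler_pXn2r ?nnegrE ?(ltW an_gt0).
pose de : R := t%:R / n%:R; pose l := a - de.
have deE : de * n%:R = t%:R by rewrite /de divfK // gt_eqF.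
have de_gt0 : 0 < de by rewrite -(pmulr_lgt0 _ n_gt0) deE; lra.
have de_le : de <= a by rewrite -(ler_pM2r n_gt0) deE.
have l_bounds : 0 <= l <= a by rewrite /l; apply/andP; split; lra.
have /andP[l0 la] := l_bounds.
pose keep (j : 'I_d) : R :=
  if (j < k)%N then a / alpha j else if j == k then l / a else 0.
set r := coin alpha keep.
have r0 : forall e, 0 <= r e by apply: coin_ge0 => // j; apply: keep01.
have r1 : \sum_e r e = 1 by apply: coin_sum1.
pose A (e : 'I_d * bool) := e.2 && (e.1 == k).
pose Y s := (count A s - rsk_row k (map fst s))%N.
rewrite -(expect_coin alpha keep).
apply: le_trans (_ : expect r n (fun s => 3 * (- (l * n%:R) + (count A s)%:R) ^+ 2
    + (3 * t%:R ^+ 2 + 3 * (Y s)%:R ^+ 2)) <= _).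
  apply: ler_expect => // s _.
  have H : (count A s)%:R <= (rsk_row k (map fst s))%:R + (Y s)%:R :> R.
    by rewrite -natrD ler_nat -leq_subLR.
  apply: le_trans (sqr_max0_le (y := - (- (l * n%:R) + (count A s)%:R)
     + t%:R + (Y s)%:R) _) _; first by rewrite /l mulrBl deE; lra.
  by apply: le_trans (sqr_add3_le _ _ _) _; rewrite sqrrN; lra.
rewrite !expectD !expectZ (expect_count r1) expect_cst //.
have pE : \sum_(e | A e) r e = l.
  rewrite sum_coin (bigD1 k) //= big1 ?addr0; last first.
    by move=> j /negbTE jk; rewrite /A /= jk addr0.
  by rewrite /A /= eqxx /r /coin /keep /= ltnn eqxx -/a ?addr0 mulrC divfK // gt_eqF.
rewrite pE.
pose rs : seq R := nseq k l.
have rs_le : all (fun x => 0 <= x <= a - de) rs.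
  by rewrite /rs all_nseq l0 /= lexx orbT.
have qsE : [seq x / a | x <- rs] = nseq k (l / a) by rewrite /rs map_nseq.
have rs_sum : \sum_(x <- rs) x = k%:R * l.
  by rewrite /rs big_nseq iter_addr addr0 mulr_natl.
have YE : expect r n (fun s => (Y s)%:R ^+ 2)
   <= 2 * (gmean [seq x / a | x <- rs] ^+ 2 + gvar [seq x / a | x <- rs]).
  have qs0 : all (>= 0) [seq x / a | x <- rs].
    by rewrite qsE all_nseq divr_ge0 // orbT.
  apply: (@queue_sqr_le R _ r r0 r1 (lower_step k) _ qs0 _ n n Y).
  - by move=> N f f0; rewrite qsE; apply: lower_step_inv.
  - have := @map_div_le R a de rs; rewrite a_gt0 a1 => /(_ isT (ltW de_gt0) rs_le).
    apply: sub_all => q /le_trans; apply.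
    by rewrite lerD2l lerN2 -[n%:R^-1]mul1r ler_pdivrMr // deE.
  - by rewrite -(ltr_nat R).
  - move=> c s cs _; rewrite /Y leq_subLR; apply: row_ge_queue.
    by rewrite cs size_map size_nseq.
have mean_le := gmean_map_le de_gt0 rs_le.
have var_le := gvar_map_le de_gt0 rs_le.
pose z := a / de.
have z0 : 0 <= z by rewrite divr_ge0 // ltW.
have k0 : 0 <= k%:R :> R by [].
have mean2 : gmean [seq x / a | x <- rs] ^+ 2 <= k%:R ^+ 2 * z ^+ 2.
  have g0 : 0 <= gmean [seq x / a | x <- rs].
    rewrite qsE /gmean big_seq sumr_ge0 // => x /nseqP[-> _].
    by rewrite divr_ge0 ?divr_ge0 // subr_ge0 ler_pdivrMr ?mul1r.
  rewrite -exprMn ler_pXn2r ?nnegrE ?(mulr_ge0 k0 z0) //; apply: le_trans mean_le _.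
  rewrite rs_sum /z mulrA ler_wpM2r ?invr_ge0 ?(ltW de_gt0) //.
  by rewrite ler_wpM2l.
have var2 : gvar [seq x / a | x <- rs] <= k%:R * z ^+ 2.
  apply: le_trans var_le _; rewrite (_ : k%:R * z ^+ 2 = k%:R * a ^+ 2 / de ^+ 2); last first.
    by rewrite /z exprMn exprVn mulrA.
  apply: ler_wpM2r; first by rewrite invr_ge0 sqr_ge0.
  by rewrite rs_sum expr2 -mulrA ler_wpM2l // ler_wpM2r.
have z2 : z ^+ 2 * K <= 4 * (a * n%:R).
  have zt : z * t%:R = a * n%:R by rewrite -deE /z; field; rewrite lt0r_neq0.
  have t2 : K * (a * n%:R) <= (2 * t%:R) ^+ 2.
    by apply: le_trans (ltW t_gt) _; rewrite lerXn2r ?nnegrE // -?natr1; lra.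
  have tt0 : 0 < t%:R ^+ 2 :> R by rewrite exprn_gt0 //; lra.
  rewrite -(ler_pM2r tt0).
  have -> : z ^+ 2 * K * t%:R ^+ 2 = (a * n%:R) * (K * (a * n%:R)).
    by rewrite -zt; ring.
  have := ler_wpM2l (ltW an_gt0) t2.
  by rewrite expr2; lra.
have -> : - (l * n%:R) + n%:R * l = 0 by ring.
have l1 : n%:R * (l * (1 - l)) <= a * n%:R.
  by rewrite mulrC ler_wpM2r //; apply: le_trans la; rewrite ler_piMr // gerBl.
rewrite expr0n add0r.
have kz : (k%:R ^+ 2 + k%:R) * z ^+ 2 <= k%:R * (4 * (a * n%:R)).
  have := ler_wpM2l k0 z2; rewrite KE; lra.
have kK : 1 * (a * n%:R) <= K * (a * n%:R) by rewrite ler_wpM2r // ltW.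
(* In units of [a * n] the three parts give [3], [3 * K] and [24 * k], and [k = K - 1] keeps the sum
   below [27 * K]. *)
move: (expect _ _ _) YE => e YE; rewrite KE in t_le kK *; lra.
Qed.

Lemma row_lower :
  expect alpha n (fun s => Num.max 0 (a * n%:R - (rsk_row k s)%:R) ^+ 2)
  <= 27 * (k.+1%:R * (a * n%:R)).
Proof.
have [large|/ltW/row_lower_small small] := leP (k.+1%:R : R) (a * n%:R).
  exact: row_lower_large.
apply: le_trans small _; rewrite ler_peMl //; last by lra.
by rewrite !mulr_ge0.
Qed.

End Rows.

(** * Excess and deficit combined *)

Unset Implicit Arguments.

(* k : 'I_d is 0-indexed: it stands for the paper's index k+1, so
   lambda_{k+1}, alpha_{k+1}, the factor (k+1), and the tail sum over j >= k. *)
Theorem mainTheorem2 (R : realFieldType) (d : nat) (alpha : 'I_d -> R)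
  (alpha_ge0 : forall i : 'I_d, 0 <= alpha i)
  (alpha_sum1 : \sum_(i : 'I_d) alpha i = 1)
  (alpha_sorted : forall i j : 'I_d, (i <= j)%N -> alpha j <= alpha i)
  (n : nat) (k : 'I_d) :
  \sum_(w : word d n)
      word_prob alpha w * ((shRSK_row w k)%:R - alpha k * n%:R) ^+ 2
  <= 42%:R * alpha k * (k.+1)%:R * n%:R
     + 42%:R * (\sum_(j : 'I_d | (k <= j)%N) alpha j) * n%:R.
Proof.
rewrite (word_sum_expect alpha k
  (fun w => ((shRSK_row w k)%:R - alpha k * n%:R) ^+ 2)).
have rowE s : size s = n ->
  shRSK_row [ffun i : 'I_n => nth k s i] k = rsk_row k s by move<-.
have up := row_upper k n alpha_ge0 alpha_sum1 alpha_sorted.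
have low := row_lower k n alpha_ge0 alpha_sum1 alpha_sorted.
apply: le_trans (_ : expect alpha n (fun s =>
  Num.max 0 ((rsk_row k s)%:R - alpha k * n%:R) ^+ 2
  + Num.max 0 (alpha k * n%:R - (rsk_row k s)%:R) ^+ 2) <= _).
  apply: ler_expect => // s ss; rewrite rowE //.
  by rewrite -[alpha k * n%:R - _]opprB sqr_max0_split.
rewrite expectD; apply: le_trans (lerD up low) _.
set p := \sum_(j | _) _.
have pn0 : 0 <= p * n%:R by rewrite mulr_ge0 ?sumr_ge0.
have an0 : 0 <= alpha k * n%:R by rewrite mulr_ge0.
have aKn : 1 * (alpha k * n%:R) <= k.+1%:R * (alpha k * n%:R).
  by rewrite ler_wpM2r // ler1n.
have -> : 42%:R * alpha k * k.+1%:R * n%:R = 42%:R * (k.+1%:R * (alpha k * n%:R)).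
  by ring.
(* The total is at most [(3 + 27) * x + 34 * y], within the constant 42. *)
rewrite -[42%:R * p * _]mulrA; move: (k.+1%:R * _) (p * _) aKn pn0 an0 => x y; lra.
Qed.
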